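(* Let $h_0,h_1,h_2,h_3:\mathbb{Z}_{15}\to\mathbb{Z}_{15}$ be the functions whose lists of values $(h_i(0),h_i(1),\dots,h_i(14))$ (modulo $15$) are \[ \begin{aligned} h_0&:\ (0,0,0,0,0,0,0,0,0,0,0,0,0,0,0),\\ h_1&:\ (0,1,2,3,4,5,6,7,8,9,10,11,12,13,14),\\ h_2&:\ (0,9,3,2,13,11,10,12,4,6,8,14,7,5,1),\\ h_3&:\ (0,12,4,11,10,9,5,2,6,14,7,3,13,1,8). \end{aligned} \] Then $h_0,h_1,h_2,h_3$ form a clique of size $4$ in the graph $G_{15}$. Consequently, the size of the largest clique in $G_{15}$ is not equal to $p(15)=3$, so the equality $\omega(k)=p(k)$ fails for $k=15$.
   Context: For a positive integer $k$, $\mathbb{Z}_k$ denotes the integers modulo $k$. $G_k$ is the simple graph whose vertices are all functions $f:\mathbb{Z}_k\to\mathbb{Z}_k$, where two distinct vertices $f,g$ form an edge if and only if the pointwise difference $f-g$ (taken modulo $k$) is a bijection $\mathbb{Z}_k\to\mathbb{Z}_k$. $\omega(k)$ denotes the size of the largest clique (complete subgraph) in $G_k$, and for $k\geq 2$, $p(k)$ denotes the smallest prime factor of $k$. *)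

(* Defs.v *)
From mathcomp Require Import all_boot all_order all_algebra.
Set Implicit Arguments.
Unset Strict Implicit.
Unset Printing Implicit Defensive.
Import GRing.Theory.
Local Open Scope ring_scope.

(* The ring ['Z_k] of the library is the integers modulo [max k 2]. The additive
   group ['I_k.-1.+1] is the integers modulo [k] for every [k > 0], [k = 1]
   included. It is convertible to ['I_15] for [k = 15]. *)
Notation Zmod k := 'I_(k.-1.+1).

Definition vertex (k : nat) := {ffun Zmod k -> Zmod k}.

Definition bijectiveb (aT rT : finType) (f : aT -> rT) : bool :=
  injectiveb f && [forall y : rT, [exists x : aT, f x == y]].

Lemma bijectiveP (aT rT : finType) (f : aT -> rT) :
  reflect (bijective f) (bijectiveb f).
Proof.
apply: (iffP andP) => [[/injectiveP f_inj /forallP f_surj]|[g fK gK]].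
  have ex y : exists x, f x == y by apply/existsP.
  exists (fun y => xchoose (ex y)) => [x|y].
    by apply/f_inj/eqP/(xchooseP (ex (f x))).
  exact/eqP/(xchooseP (ex y)).
split; first exact/injectiveP/(can_inj fK).
by apply/forallP => y; apply/existsP; exists (g y); rewrite gK.
Qed.

Definition Gedge (k : nat) : rel (vertex k) :=
  fun f g => (f != g) && bijectiveb (fun x : Zmod k => f x - g x).

Lemma Gedge_irrefl (k : nat) : irreflexive (@Gedge k).
Proof. by move=> f; rewrite /Gedge eqxx. Qed.

Lemma Gedge_sym (k : nat) : symmetric (@Gedge k).
Proof.
move=> f g; rewrite /Gedge eq_sym; congr (_ && _).
wlog suff: f g / bijectiveb (fun x => f x - g x) ->
    bijectiveb (fun x => g x - f x).
  by move=> H; apply/idP/idP; apply: H.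
move/bijectiveP => bij_fg; apply/bijectiveP.
apply: (eq_bij (bij_comp (inv_bij (@opprK (Zmod k))) bij_fg)) => x /=.
exact: opprB.
Qed.

Definition is_clique (T : finType) (e : rel T) (A : {set T}) : bool :=
  [forall x in A, forall y in A, (x != y) ==> e x y].

Definition clique_number (T : finType) (e : rel T) : nat :=
  \max_(A : {set T} | is_clique e A) #|A|.

Definition omega (k : nat) : nat := clique_number (@Gedge k).

Definition of_values (k : nat) (s : seq nat) : vertex k :=
  [ffun i : Zmod k => inZp (nth 0%N s i)].

(* Main.v *)
Require Import Defs.
From mathcomp Require Import all_boot all_order all_algebra.

(** A clique of size 4 already beats [pdiv 15], which is 3. Each of the six differences of the given
    functions takes 15 distinct values modulo 15, hence is a bijection, [Zmod 15] being finite.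
    [Gedge_of_values] turns this into a computation on lists of naturals, and [pairwise_is_clique]
    assembles the six edges. *)

Lemma Gedge_of_values (k : nat) (s t : seq nat) : 1 < k ->
  uniq [seq (nth 0 s i + (k - nth 0 t i %% k)) %% k | i <- iota 0 k] ->
  Gedge (of_values k s) (of_values k t).
Proof.
case: k => [|[|n]] // _ diff_uniq.
set f := of_values _ s; set g := of_values _ t.
have diff_inj : injective (fun x : 'I_n.+2 => (f x - g x)%R).
  (* The opposite of a residue [b] is represented by [k - b %% k], so the values of [f - g] are the
     entries of the list. *)
  move=> x y /(congr1 val); rewrite !ffunE /= !modnDml !modnDmr => eq_xy.
  pose d i := (nth 0 s i + (n.+2 - nth 0 t i %% n.+2)) %% n.+2.
  have nth_d (z : 'I_n.+2) : nth 0 [seq d i | i <- iota 0 n.+2] z = d z.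
    by rewrite (nth_map 0) ?nth_iota ?size_iota.
  apply/ord_inj/eqP; rewrite -(nth_uniq 0 _ _ diff_uniq) ?size_map ?size_iota //.
  by apply/eqP; rewrite !nth_d.
rewrite /Gedge; apply/andP; split.
  (* If [f = g], the injective difference is constantly 0, yet [ord0] and [ord_max] differ because
     [1 < k]. *)
  apply/eqP => eq_fg.
  by have /diff_inj : (f ord0 - g ord0 = f ord_max - g ord_max)%R
    by rewrite eq_fg !GRing.subrr.
exact/bijectiveP/injF_bij.
Qed.

(** [pairwise] tests each pair in one order only; symmetry supplies the other. *)
Lemma pairwise_is_clique (T : finType) (e : rel T) (s : seq T) :
  symmetric e -> pairwise e s -> is_clique e [set x in s].
Proof.
move=> e_sym; elim: s => [|z s IHs] /=.
  by move=> _; apply/forall_inP => x; rewrite inE.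
case/andP=> /allP ez /IHs /forall_inP cl_s.
apply/forall_inP => x; rewrite inE in_cons => xs.
apply/forall_inP => y; rewrite inE in_cons => ys; apply/implyP => neq_xy.
case/predU1P: xs neq_xy => [->|xs]; case/predU1P: ys => [->|ys].
- by rewrite eqxx.
- by rewrite ez.
- by rewrite e_sym ez.
have xS : x \in [set x in s] by rewrite inE.
have yS : y \in [set x in s] by rewrite inE.
by move: (cl_s x xS) => /forall_inP /(_ y yS) /implyP.
Qed.

Lemma leq_clique_number (T : finType) (e : rel T) (A : {set T}) :
  is_clique e A -> #|A| <= clique_number e.
Proof. exact: (@leq_bigmax_cond _ (is_clique e) (fun B : {set T} => #|B|)). Qed.

Theorem mainTheorem1 (h0 h1 h2 h3 : vertex 15)
  (h0E : h0 = of_values 15 [:: 0; 0; 0; 0; 0; 0; 0; 0; 0; 0; 0; 0; 0; 0; 0])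
  (h1E : h1 = of_values 15 [:: 0; 1; 2; 3; 4; 5; 6; 7; 8; 9; 10; 11; 12; 13; 14])
  (h2E : h2 = of_values 15 [:: 0; 9; 3; 2; 13; 11; 10; 12; 4; 6; 8; 14; 7; 5; 1])
  (h3E : h3 = of_values 15 [:: 0; 12; 4; 11; 10; 9; 5; 2; 6; 14; 7; 3; 13; 1; 8]) :
  [/\ is_clique (@Gedge 15) [set h0; h1; h2; h3],
      #|[set h0; h1; h2; h3]| = 4,
      pdiv 15 = 3 &
      omega 15 <> pdiv 15].
Proof.
have pw : pairwise (@Gedge 15) [:: h0; h1; h2; h3].
  by rewrite h0E h1E h2E h3E /= !Gedge_of_values.
have setE : [set h0; h1; h2; h3] = [set x in [:: h0; h1; h2; h3]].
  by apply/setP => x; rewrite !inE !orbA.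
have cl : is_clique (@Gedge 15) [set h0; h1; h2; h3].
  by rewrite setE; apply: (pairwise_is_clique _ _ _ _ pw); apply: Gedge_sym.
have card4 : #|[set h0; h1; h2; h3]| = 4.
  (* Irreflexivity rules out repetitions in a pairwise adjacent list. *)
  by rewrite setE cardsE; apply/card_uniqP/(pairwise_uniq _ pw)/Gedge_irrefl.
split=> // omega_p.
(* Equality would give [4 <= pdiv 15], which evaluates to false. *)
by have := leq_clique_number _ _ _ cl; rewrite card4 -/(omega 15) omega_p.
Qed.
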